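(* Let $F$ be a Markov chain on a measurable space $S$ and $p:S\to\{1,\dots,d\}$ a measurable priority function. If there exists a lexicographic progress-measure supermartingale for $(F,p)$, then $\mathbb{P}_{x_0}[\mathbf{Parity}(p)]=1$ for every initial state $x_0\in S$.
   Context: A Markov chain on a measurable space $S$ is a Markov kernel $F$ from $S$ to $S$; write $F_s$ for $F(s,\cdot)$; $(\mathbb{X}g)(s)=\int g\,dF_s$ for measurable $g:S\to[0,\infty]$, applied componentwise to vector-valued functions. On $[0,\infty]^n$: $a\succ b$ iff there is $l$ with $a_i\ge b_i$ for $i<l$ and $a_l\ge1+b_l$; $a\succeq b$ iff $a\succ b$ or $a_i\ge b_i$ for all $i$. For positive integers $m_1,\dots,m_d$, nested orders on $\prod_{i=1}^d[0,\infty]^{m_i}$: $(r_1,\dots,r_d)\succ^{(2)}(r'_1,\dots,r'_d)$ iff there is $l$ with $r_i\succeq r'_i$ for all $i<l$ and $r_l\succ r'_l$; $r\succeq^{(2)}r'$ iff $r\succ^{(2)}r'$ or $r_i\succeq r'_i$ for all $i$. For $j\le d$, $r\succ^{(2)}_j r'$ (resp. $\succeq^{(2)}_j$) means $(r_1,\dots,r_j)\succ^{(2)}(r'_1,\dots,r'_j)$ (resp. $\succeq^{(2)}$). A lexicographic progress-measure supermartingale (LexPMSM) for $(F,p)$ is a measurable $r:S\to\prod_{i=1}^d[0,\infty)^{m_i}$ (for some positive integers $m_i$) such that for each $x\in S$: if $p(x)$ is even then $r(x)\succeq^{(2)}_{p(x)}(\mathbb{X}r)(x)$, and if $p(x)$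 is odd then $r(x)\succ^{(2)}_{p(x)}(\mathbb{X}r)(x)$. For $x_0\in S$, $\mathbb{P}_{x_0}$ is the unique probability measure on $S^\omega$ (cylinder $\sigma$-algebra) of trajectories $x_1x_2\dots$ such that for measurable $g:S^n\to[0,\infty]$, $\int g(x_1,\dots,x_n)\,d\mathbb{P}_{x_0}=\int\cdots\int g\,dF_{x_{n-1}}(x_n)\cdots dF_{x_0}(x_1)$. $\mathbf{Parity}(p)$ is the set of sequences whose minimal priority occurring infinitely often is even. *)

(* Defs.v *)
From HB Require Import structures.
From mathcomp Require Import all_boot all_order all_algebra.
From mathcomp Require Import all_classical all_reals all_analysis.
From mathcomp Require Import measurable_realfun.

Set Implicit Arguments.
Unset Strict Implicit.
Unset Printing Implicit Defensive.
Import Order.TTheory GRing.Theory Num.Theory.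

Local Open Scope classical_set_scope.
Local Open Scope ring_scope.

(* The orders are meant for vectors with entries in [0, +oo], where addition
   of extended reals has no indeterminate case; in particular
   +oo >= 1 + +oo. *)

Definition lex_gt (R : realType) (n : nat) (a b : 'I_n -> \bar R) : Prop :=
  exists l : 'I_n,
    (forall i : 'I_n, (i < l)%N -> (b i <= a i)%E) /\ (1 + b l <= a l)%E.

Definition lex_ge (R : realType) (n : nat) (a b : 'I_n -> \bar R) : Prop :=
  lex_gt a b \/ (forall i : 'I_n, (b i <= a i)%E).

(* The block of 0-based index i is r_(i+1), so the prefix (r_1, ..., r_j)
   consists of the blocks of index i < j. For j = d these are the orders on
   the whole product. *)

Definition nested_gt (R : realType) (d : nat) (m : 'I_d -> nat) (j : nat)
    (r r' : forall i : 'I_d, 'I_(m i) -> \bar R) : Prop :=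
  exists l : 'I_d, [/\ (l < j)%N,
    forall i : 'I_d, (i < l)%N -> lex_ge (r i) (r' i) & lex_gt (r l) (r' l)].

Definition nested_ge (R : realType) (d : nat) (m : 'I_d -> nat) (j : nat)
    (r r' : forall i : 'I_d, 'I_(m i) -> \bar R) : Prop :=
  nested_gt j r r' \/
  (forall i : 'I_d, (i < j)%N -> lex_ge (r i) (r' i)).

(* The operator g |-> X g. *)
Definition next_expectation (R : realType) (disp : measure_display)
    (S : measurableType disp) (F : R.-pker S ~> S) (g : S -> \bar R) (s : S) :
    \bar R :=
  (\int[F s]_y g y)%E.

Definition is_LexPMSM (R : realType) (disp : measure_display)
    (S : measurableType disp) (F : R.-pker S ~> S) (p : S -> nat)
    (d : nat) (m : 'I_d -> nat)
    (r : S -> forall i : 'I_d, 'I_(m i) -> R) : Prop :=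
  let r_ x i k := (r x i k)%:E in
  let Xr x i k := next_expectation F (fun y => r_ y i k) x in
  [/\ forall x i k, 0 <= r x i k,
      forall i k, measurable_fun [set: S] (fun x => r x i k),
      forall x, ~~ odd (p x) -> nested_ge (p x) (r_ x) (Xr x) &
      forall x, odd (p x) -> nested_gt (p x) (r_ x) (Xr x)].

Definition has_LexPMSM (R : realType) (disp : measure_display)
    (S : measurableType disp) (F : R.-pker S ~> S) (p : S -> nat)
    (d : nat) : Prop :=
  exists m : 'I_d -> nat, (forall i, (0 < m i)%N) /\
  exists r : S -> forall i : 'I_d, 'I_(m i) -> R, is_LexPMSM F p r.

Definition cylinder (disp : measure_display) (S : measurableType disp) :
    set (set (nat -> S)) :=
  [set C | exists (n : nat) (A : nat -> set S), (forall i, measurable (A i)) /\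
     C = [set w | forall i, (i < n)%N -> A i (w i)]].

(* S^omega with the cylinder sigma-algebra. A trajectory x_1 x_2 ... is the
   function w with w i = x_(i+1); the initial state x_0 is not part of it. *)
Definition traj (disp : measure_display) (S : measurableType disp) :=
  g_sigma_algebraType (@cylinder disp S).

Definition traj_prefix (disp : measure_display) (S : measurableType disp)
    (n : nat) (w : traj S) : n.-tuple S :=
  [tuple (w : nat -> S) (nat_of_ord i) | i < n].

(* int ... int g(x_1, ..., x_n) dF_(x_(n-1))(x_n) ... dF_(x_0)(x_1) *)
Fixpoint iterated_integral (R : realType) (disp : measure_display)
    (S : measurableType disp) (F : R.-pker S ~> S) (n : nat) (x0 : S) :
    (n.-tuple S -> \bar R) -> \bar R :=
  match n return (n.-tuple S -> \bar R) -> \bar R with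
  | 0%N => fun g => g [tuple]
  | n'.+1 => fun g =>
      (\int[F x0]_x1
         iterated_integral F x1 (fun t : n'.-tuple S => g [tuple of x1 :: t]))%E
  end.

(* P is the trajectory measure P_(x_0). *)
Definition is_trajectory_measure (R : realType) (disp : measure_display)
    (S : measurableType disp) (F : R.-pker S ~> S) (x0 : S)
    (P : probability (traj S) R) : Prop :=
  forall (n : nat) (g : n.-tuple S -> \bar R),
    measurable_fun [set: n.-tuple S] g -> (forall t, (0 <= g t)%E) ->
    (\int[P]_w g (traj_prefix n w) = iterated_integral F x0 g)%E.

Definition infinitely_often (S : Type) (p : S -> nat) (w : nat -> S)
    (k : nat) : Prop :=
  forall N : nat, exists n : nat, (N <= n)%N /\ p (w n) = k.

Definition parity (disp : measure_display) (S : measurableType disp)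
    (p : S -> nat) : set (traj S) :=
  [set w | exists k : nat, [/\ infinitely_often p w k,
     forall k', infinitely_often p w k' -> (k <= k')%N & ~~ odd k]].

(* Main.v *)
(* For a single component V of the measure, the expected number of steps at
   which V decreases by 1 in expectation, counted until V first fails to be
   nonincreasing in expectation, is at most the current value of V. By
   Borel-Cantelli, almost surely, if from some time on V is always nonincreasing
   in expectation, then it decreases only finitely often. On a trajectory with
   this property for all components, let j be the least priority occurring
   infinitely often. Lexicographic induction over the components of the first j
   blocks shows that each of them is eventually nonincreasing, hence eventually
   never decreasing; but if j were odd, each of the infinitely many visits to
   priority j would decrease one of them. *)
Require Import Defs.
From HB Require Import structures.
From mathcomp Require Import all_boot all_order all_algebra.
From mathcomp Require Import all_classical all_reals all_analysis.
From mathcomp Require Import measurable_realfun.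
From mathcomp Require Import zify.

Local Open Scope classical_set_scope.

Set Implicit Arguments.
Unset Strict Implicit.
Unset Printing Implicit Defensive.
Import Order.TTheory GRing.Theory Num.Theory.

(** * Probabilities of cylinder events *)

Section cylinder_events.
Local Open Scope ring_scope.
Context {R : realType} {disp : measure_display} {S : measurableType disp}.
Implicit Types (F : R.-pker S ~> S) (s : seq (set S)).

Definition cylinder_of s : set (traj S) :=
  [set w | forall i, (i < size s)%N -> nth setT s i (w i)].

Definition tuple_cylinder s : set ((size s).-tuple S) :=
  [set t | forall i : 'I_(size s), nth setT s i (tnth t i)].
Arguments tuple_cylinder : clear implicits.

(* For s = A_0 ... A_(n-1), the probability that the chain started in y (time 0
   included) is in A_i at each time i < n. *)
Fixpoint path_weight F s (y : S) : \bar R :=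
  match s with
  | [::] => 1%E
  | A :: s' => ((\1_A y)%:E * \int[F y]_z path_weight F s' z)%E
  end.

Lemma measurable_next_expectation F (g : S -> \bar R) :
  (forall x, (0 <= g x)%E) -> measurable_fun [set: S] g ->
  measurable_fun [set: S] (next_expectation F g).
Proof.
move=> g0 mg; apply: (@measurable_fun_integral_kernel _ _ _ _ _ F) => //.
by move=> U mU; exact: measurable_kernel.
Qed.

Lemma path_weight_ge0 F s y : (0 <= path_weight F s y)%E.
Proof.
elim: s y => [|A s IH] y //=; apply: mule_ge0; first by rewrite lee_fin.
exact: integral_ge0.
Qed.

Lemma measurable_path_weight F s :
  (forall A, A \in s -> measurable A) ->
  measurable_fun [set: S] (path_weight F s).
Proof.
elim: s => [|A s IH] mS /=; first exact: measurable_cst.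
have mA : measurable A by apply: mS; rewrite mem_head.
apply: emeasurable_funM.
  by apply/measurable_EFinP; exact: measurable_indic.
apply: measurable_next_expectation; first exact: path_weight_ge0.
by apply: IH => B sB; apply: mS; rewrite in_cons sB orbT.
Qed.

Lemma iterated_integral0 F n (x : S) :
  iterated_integral F x (fun _ : n.-tuple S => 0%E) = 0%E.
Proof.
elim: n x => [|n IH] x //=.
by under eq_integral do rewrite IH; rewrite integral0.
Qed.

(** Split on the first state [y]: if [y] is in [A], the indicator at [y :: t] is that of the
    remaining sets at [t]; otherwise the integrand vanishes. *)
Lemma iterated_integral_cylinder F s x :
  iterated_integral F x (fun t => (\1_(tuple_cylinder s) t)%:E) =
  (\int[F x]_y path_weight F s y)%E.
Proof.
elim: s x => [|A s IH] x /=.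
  rewrite integral_cst// mul1e prob_kernel indicE mem_set//.
  by case.
apply: eq_integral => y _; rewrite -IH.
have [yA|yA] := boolP (y \in A).
  rewrite [\1_A y]indicE yA mul1e; congr iterated_integral.
  apply/funext => t; rewrite !indicE; congr (nat_of_bool _)%:R%:E.
  apply/idP/idP => /set_mem /= h; apply/mem_set.
    move=> i; have := h (lift ord0 i).
    by rewrite /= (tnth_nth y) /= -tnth_nth.
  move=> i; rewrite (tnth_nth y); case: i => [[|i]] /= Hi.
    exact/set_mem.
  by have := h (Ordinal (Hi : (i < size s)%N)); rewrite (tnth_nth y).
rewrite [\1_A y]indicE (negbTE yA) mul0e.
rewrite [LHS](_ : _ = iterated_integral F y (fun _ : (size s).-tuple S => 0%E)).
  exact: iterated_integral0.
congr iterated_integral.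
apply/funext => t; rewrite indicE memNset//= => h.
have := h ord0; rewrite (tnth_nth y)/= => /mem_set.
by rewrite (negbTE yA).
Qed.

Lemma measurable_tuple_cylinder s :
  (forall A, A \in s -> measurable A) -> measurable (tuple_cylinder s).
Proof.
move=> mS.
have -> : tuple_cylinder s = \bigcap_(i in [set: 'I_(size s)])
    ((@tnth _ S ^~ i) @^-1` nth setT s i).
  by apply/seteqP; split => [t h i _|t h i]; exact: h.
apply: fin_bigcap_measurable => // i _.
rewrite -[X in measurable X]setTI; apply: measurable_tnth => //.
by apply: mS; exact: mem_nth.
Qed.

Lemma measurable_cylinder_of s :
  (forall A, A \in s -> measurable A) -> measurable (cylinder_of s).
Proof.
(* [cylinder] asks for measurable sets at every index; past the end of [s] the default [setT]
   provides them. *)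
move=> mS; apply: sub_sigma_algebra; exists (size s), (nth setT s).
split=> // i; have [si|si] := ltnP i (size s).
  by apply: mS; exact: mem_nth.
by rewrite nth_default.
Qed.

(** The defining property of [P] enters here, applied to the indicator of a tuple cylinder; the
    later estimates only concern [path_weight]. *)
Lemma trajectory_measure_cylinder F x0 (P : probability (traj S) R) s :
  is_trajectory_measure F x0 P -> (forall A, A \in s -> measurable A) ->
  P (cylinder_of s) = (\int[F x0]_y path_weight F s y)%E.
Proof.
move=> P_traj mS; rewrite -iterated_integral_cylinder -P_traj; last 2 first.
- apply/measurable_EFinP; apply: measurable_indic.
  exact: measurable_tuple_cylinder.
- by move=> t; rewrite lee_fin.
rewrite -(setIT (cylinder_of s)) -integral_indic//; last first.
  exact: measurable_cylinder_of.
apply: eq_integral => w _; rewrite !indicE; congr (nat_of_bool _)%:R%:E.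
apply/idP/idP => /set_mem /= h; apply/mem_set.
  by move=> i; rewrite tnth_mktuple; exact: h.
by move=> i si; have := h (Ordinal si); rewrite tnth_mktuple.
Qed.

End cylinder_events.

(** * Counting the decreases of a single nonnegative component *)

Section supermartingale.
Local Open Scope ring_scope.
Context {R : realType} {disp : measure_display} {S : measurableType disp}.
Context (F : R.-pker S ~> S) (V : S -> R).
Context (V_ge0 : forall x, (0 <= V x)%R).
Context (V_meas : measurable_fun [set: S] V).

Let XV := next_expectation F (EFin \o V).

Definition nonincreasing_at : set S := [set x | (XV x <= (V x)%:E)%E].

Definition decreasing_at : set S := [set x | (1 + XV x <= (V x)%:E)%E].

Definition below_at (K : nat) : set S := [set x | (XV x <= K%:R%:E)%E].

Let measurable_XV : measurable_fun [set: S] XV.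
Proof.
apply: measurable_next_expectation => [x|]; first by rewrite lee_fin.
exact/measurable_EFinP.
Qed.

Lemma measurable_nonincreasing_at : measurable nonincreasing_at.
Proof.
rewrite -[X in measurable X]setTI; apply: measurable_lee => //.
exact/measurable_EFinP.
Qed.

Lemma measurable_decreasing_at : measurable decreasing_at.
Proof.
rewrite -[X in measurable X]setTI; apply: measurable_lee => //.
  exact: emeasurable_funD.
exact/measurable_EFinP.
Qed.

Lemma measurable_below_at K : measurable (below_at K).
Proof.
by rewrite -[X in measurable X]setTI; apply: measurable_lee.
Qed.

Lemma decreasing_nonincreasing_at : decreasing_at `<=` nonincreasing_at.
Proof.
move=> x; apply: le_trans; rewrite leeDr//.
Qed.

(** Summed over [l], the path weights give the expected number of decreases before [V] first fails
    to be nonincreasing. *)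
Definition monotone_hit l : seq (set S) :=
  ncons l nonincreasing_at [:: decreasing_at].

(* XV is bounded at time N, not before: the expectation of V at time N may be
   infinite. *)
Definition delayed_hit K N l : seq (set S) :=
  ncons N setT (below_at K :: monotone_hit l).

Lemma measurable_monotone_hit l A : A \in monotone_hit l -> measurable A.
Proof.
elim: l => [|l IH] /=; rewrite inE.
  by move=> /eqP ->; exact: measurable_decreasing_at.
by move=> /orP[/eqP ->|//]; exact: measurable_nonincreasing_at.
Qed.

Lemma measurable_delayed_hit K N l A : A \in delayed_hit K N l -> measurable A.
Proof.
elim: N => [|N IH] /=; rewrite inE => /orP[/eqP ->|//].
- exact: measurable_below_at.
- exact: measurable_monotone_hit.
- exact: measurableT.
Qed.

Let sum_integral_path_weight_le (s : nat -> seq (set S)) (h : S -> \bar R) L y :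
  (forall l A, A \in s l -> measurable A) -> measurable_fun [set: S] h ->
  (forall z, (\sum_(l < L) path_weight F (s l) z <= h z)%E) ->
  (\sum_(l < L) \int[F y]_z path_weight F (s l) z <= \int[F y]_z h z)%E.
Proof.
move=> ms mh sum_le.
have mw l : measurable_fun [set: S] (path_weight F (s l)).
  by apply: measurable_path_weight; exact: ms.
rewrite -ge0_integral_sum//; last by move=> l z _; exact: path_weight_ge0.
apply: ge0_le_integral => //; last exact: emeasurable_sum.
by move=> z _; apply: sume_ge0 => l _; exact: path_weight_ge0.
Qed.

(** Induction on [L], conditioning on the first step. The term [l = 0] is the indicator of
    [decreasing_at]; by induction the others add at most [XV y], and only on [nonincreasing_at]. So
    the sum is at most [1 + XV y], [XV y] or 0 in the three cases, hence at most [V y]. *)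
Lemma sum_monotone_hit_le L y :
  (\sum_(l < L) path_weight F (monotone_hit l) y <= (V y)%:E)%E.
Proof.
elim: L y => [|L IH] y; first by rewrite big_ord0 lee_fin.
rewrite big_ord_recl /= integral_cst// mul1e prob_kernel mule1.
rewrite -ge0_sume_distrr; last first.
  by move=> l _; apply: integral_ge0 => z _; exact: path_weight_ge0.
have := sum_integral_path_weight_le y measurable_monotone_hit
  (iffRL (measurable_EFinP _ _) V_meas) IH.
rewrite -/(XV y) => le_XV; rewrite !indicE.
have [yA|yA] := boolP (y \in nonincreasing_at); last first.
  rewrite memNset; first by rewrite mul0e adde0 lee_fin.
  by move=> /decreasing_nonincreasing_at/mem_set; exact/negP.
rewrite mul1e; have [yB|yB] := boolP (y \in decreasing_at).
  by apply: le_trans (set_mem yB); exact: leeD.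
by rewrite add0e; apply: le_trans (set_mem yA).
Qed.

(** At time [N] the remaining sum integrates to at most [XV], which is at most [K] on [below_at K].
    The earlier free steps average a constant bound against probability measures, so the bound does
    not depend on [N] or [y]. *)
Lemma sum_delayed_hit_le K N L y :
  (\sum_(l < L) path_weight F (delayed_hit K N l) y <= K%:R%:E)%E.
Proof.
elim: N y => [|N IH] y /=; rewrite -ge0_sume_distrr; first last.
- by move=> l _; apply: integral_ge0 => z _; exact: path_weight_ge0.
- rewrite indicT mul1e -[leRHS]mule1 -(prob_kernel (s := F) y) -integral_cst//.
  exact: (sum_integral_path_weight_le _ (@measurable_delayed_hit K N)).
- by move=> l _; apply: integral_ge0 => z _; exact: path_weight_ge0.
rewrite indicE; have [yW|yW] := boolP (y \in below_at K); last by rewrite mul0e lee_fin.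
rewrite mul1e; apply: le_trans (set_mem yW).
apply: (sum_integral_path_weight_le _ measurable_monotone_hit).
  exact/measurable_EFinP.
by move=> z; exact: sum_monotone_hit_le.
Qed.

Lemma ae_eventually_not_decreasing x0 (P : probability (traj S) R) :
  is_trajectory_measure F x0 P ->
  {ae P, forall w : traj S, (\forall n \near \oo, nonincreasing_at (w n)) ->
    \forall n \near \oo, ~ decreasing_at (w n)}.
Proof.
move=> P_traj.
pose C K N l := cylinder_of (delayed_hit K N l).
have mC K N l : measurable (C K N l).
  by apply: measurable_cylinder_of; exact: measurable_delayed_hit.
have C0 K N : P.-negligible (lim_sup_set (C K N)).
  apply/negligibleP.
    apply: bigcap_measurableType => k _; apply: bigcup_measurable => l _.
    exact: mC.
  (* Borel-Cantelli: the partial sums of the probabilities are bounded by [K]. *)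
  apply: lim_sup_set_cvg0 => //.
  apply: le_lt_trans (ltry K%:R).
  apply: lime_le; first exact: is_cvg_ereal_nneg_natsum.
  apply: nearW => L; rewrite big_mkord.
  rewrite (eq_bigr (fun l : 'I_L => \int[F x0]_y path_weight F (delayed_hit K N l) y)%E); last first.
    move=> l _; apply: trajectory_measure_cylinder => //.
    exact: measurable_delayed_hit.
  rewrite -[leRHS]mule1 -(prob_kernel (s := F) x0) -integral_cst//.
  apply: (sum_integral_path_weight_le _ (@measurable_delayed_hit K N)) => // z.
  exact: sum_delayed_hit_le.
(* An exceptional trajectory lies in the limsup for [N] the time from which [V] is nonincreasing and
   [K] an integer bound of [V (w N)]. *)
apply: negligibleS (negligible_bigcup (fun K => negligible_bigcup (C0 K))).
move=> w /= /not_implyP[[N _ wA] wB].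
have [K KV] : exists K : nat, (V (w N) <= K%:R)%R.
  by exists (Num.bound (V (w N))); exact/ltW/archi_boundP.
exists K => //; exists N => //= M _.
(* The monotone stretch starts at time [N.+1], so a decrease at time [n] has index [n - N.+1], which
   must be at least [M]. *)
have [n Mn wn] : exists2 n, ((N + M).+1 <= n)%N & decreasing_at (w n).
  apply: contrapT => noB; apply: wB; exists (N + M).+1 => // n /= Mn wn.
  by apply: noB; exists n.
exists (n - N.+1)%N => /=; first by lia.
move=> i; rewrite /delayed_hit /monotone_hit !size_ncons /= size_ncons /= => iM.
(* Times before [N] are free; then come the bound at [N], the monotone stretch, and the decrease at
   [n]. *)
rewrite nth_ncons; case: ltnP => // Ni.
have [->|iN] := eqVneq i N.
  by rewrite subnn /=; apply: le_trans (wA _ (leqnn N)) _; rewrite lee_fin.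
have -> : (i - N = (i - N.+1).+1)%N by lia.
rewrite /= nth_ncons; case: ltnP => li; first exact: wA.
have -> : i = n by lia.
by rewrite subnn.
Qed.

End supermartingale.

(** * Consequences of the nested orders for a single component *)

Section nested_orders.
Local Open Scope ring_scope.
Context {R : realType}.

(** The order says nothing about components after the strict drop [l]; the absence of decreases
    before [k] excludes [l < k]. *)
Lemma lex_ge_nonincreasing n (a b : 'I_n -> \bar R) (k : 'I_n) :
  lex_ge a b -> (forall k' : 'I_n, (k' < k)%N -> ~ (1 + b k' <= a k')%E) ->
  (b k <= a k)%E.
Proof.
case=> [[l [le_l gt_l]] nodec|ge_ab _]; last exact: ge_ab.
have [kl|lk|/val_inj ->] := ltngtP k l; first exact: le_l.
  by have := nodec l lk gt_l.
by apply: le_trans gt_l; rewrite leeDr.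
Qed.

Context {d : nat} {m : 'I_d -> nat} (r r' : forall i : 'I_d, 'I_(m i) -> \bar R).
Arguments r : clear implicits.
Arguments r' : clear implicits.

(** The same argument one level up: a strict drop in an earlier block would decrease one of its
    components. *)
Lemma nested_ge_nonincreasing j (i : 'I_d) (k : 'I_(m i)) :
  nested_ge j r r' -> (i < j)%N ->
  (forall i' : 'I_d, (i' < i)%N -> forall k' : 'I_(m i'),
    ~ (1 + r' i' k' <= r i' k')%E) ->
  (forall k' : 'I_(m i), (k' < k)%N -> ~ (1 + r' i k' <= r i k')%E) ->
  (r' i k <= r i k)%E.
Proof.
move=> ge_j ij nodec_lt nodec; apply: lex_ge_nonincreasing nodec.
case: ge_j => [[l [_ ge_l gt_l]]|]; last exact.
have [il|li|/val_inj il] := ltngtP i l; first exact: ge_l.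
  by case: gt_l => k' [_ /(nodec_lt l li)].
by rewrite il; left.
Qed.

Lemma nested_gt_decreasing j : nested_gt j r r' ->
  exists i : 'I_d, (i < j)%N /\ exists k : 'I_(m i), (1 + r' i k <= r i k)%E.
Proof. by move=> [l [lj _ [k [_ dec_k]]]]; exists l; split => //; exists k. Qed.

End nested_orders.

(** * Recurring priorities and measurability of the parity event *)

Section trajectories.
Local Open Scope ring_scope.
Context {R : realType} {disp : measure_display} {S : measurableType disp}.

Lemma not_infinitely_often (p : S -> nat) (w : nat -> S) k :
  ~ infinitely_often p w k -> \forall n \near \oo, p (w n) <> k.
Proof.
move=> /existsNP[N noN]; exists N => // n /= Nn pn.
by apply: noN; exists n.
Qed.

(** Pigeonhole: if each of the finitely many priorities were eventually avoided, all would be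
    avoided at once. *)
Lemma least_infinitely_often (p : S -> nat) (w : nat -> S) d :
  (forall n, (p (w n) <= d)%N) ->
  exists2 k, infinitely_often p w k &
    forall k', infinitely_often p w k' -> (k <= k')%N.
Proof.
move=> p_le.
have [k0 io_k0] : exists k, infinitely_often p w k.
  apply: contrapT => /forallNP no_io.
  have [N _ /(_ N (leqnn N)) /= no_p] :
      \forall n \near \oo, forall k : 'I_d.+1, p (w n) <> k.
    by apply: filter_forall => k; exact: not_infinitely_often.
  by have /= := no_p (Ordinal (p_le N : (p (w N) < d.+1)%N)).
have ex_io : exists k, `[< infinitely_often p w k >] by exists k0; exact/asboolP.
case: (ex_minnP ex_io) => k /asboolP io_k k_min; exists k => // k' io_k'.
exact/k_min/asboolP.
Qed.

Lemma eventually_ge_least (p : S -> nat) (w : nat -> S) k :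
  (forall k', infinitely_often p w k' -> (k <= k')%N) ->
  \forall n \near \oo, (k <= p (w n))%N.
Proof.
move=> k_min.
have : \forall n \near \oo, forall k' : 'I_k, p (w n) <> k'.
  apply: filter_forall => k'; apply: not_infinitely_often => /k_min.
  by rewrite leqNgt ltn_ord.
apply: filterS => n no_p; rewrite leqNgt; apply/negP => pk.
by have /= := no_p (Ordinal pk).
Qed.

Lemma measurable_coordinate n (A : set S) :
  measurable A -> measurable [set w : traj S | A (w n)].
Proof.
move=> mA; apply: sub_sigma_algebra.
exists n.+1, (fun i => if i == n then A else setT); split.
  by move=> i; case: ifP.
apply/seteqP; split => [w wA i _|w /(_ n (ltnSn n))] /=; last by rewrite eqxx.
by case: eqP => [->|].
Qed.

Lemma measurable_infinitely_often (p : S -> nat) k :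
  measurable_fun [set: S] p ->
  measurable [set w : traj S | infinitely_often p w k].
Proof.
move=> mp; rewrite (_ : [set _ | _] =
    \bigcap_N \bigcup_(n in [set n | (N <= n)%N])
      [set w : traj S | (p @^-1` [set k]) (w n)]); last first.
  apply/seteqP; split => w /= io_k N; first by move=> _; have [n []] := io_k N; exists n.
  by have [n Nn pn] := io_k N I; exists n.
apply: bigcapT_measurable => N; apply: bigcup_measurable => n _.
by apply: measurable_coordinate; rewrite -[X in measurable X]setTI; exact: mp.
Qed.

Lemma measurable_parity (p : S -> nat) :
  measurable_fun [set: S] p -> measurable (parity p).
Proof.
move=> mp; rewrite (_ : parity p = \bigcup_(k in [set k | ~~ odd k])
    ([set w : traj S | infinitely_often p w k] `&`
     \bigcap_(k' in [set k' | (k' < k)%N])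
       ~` [set w : traj S | infinitely_often p w k'])); last first.
  apply/seteqP; split => w /=.
    move=> [k [io_k k_min even_k]]; exists k => //; split => // k' /= k'k io_k'.
    by have := k_min _ io_k'; rewrite leqNgt k'k.
  move=> [k /= even_k [io_k k_min]]; exists k; split => // k' io_k'.
  by rewrite leqNgt; apply/negP => /k_min.
apply: bigcup_measurable => k _; apply: measurableI.
  exact: measurable_infinitely_often.
apply: bigcap_measurableType => k' _; apply: measurableC.
exact: measurable_infinitely_often.
Qed.

(** * Parity along a trajectory of a supermartingale *)

Context (F : R.-pker S ~> S) (p : S -> nat) (d : nat) (m : 'I_d -> nat)
  (r : S -> forall i : 'I_d, 'I_(m i) -> R).
Arguments r : clear implicits.
Context (r_PMSM : is_LexPMSM F p r).

Lemma LexPMSM_ge x :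
  nested_ge (p x) (fun i k => (r x i k)%:E)
    (fun i k => next_expectation F (fun y => (r y i k)%:E) x).
Proof.
have [_ _ ge_r gt_r] := r_PMSM.
by have [/gt_r|/ge_r] := boolP (odd (p x)); first left.
Qed.

Lemma eventually_not_decreasing (w : nat -> S) j :
  (\forall n \near \oo, (j <= p (w n))%N) ->
  (forall i k,
    (\forall n \near \oo, nonincreasing_at F (fun x => r x i k) (w n)) ->
    \forall n \near \oo, ~ decreasing_at F (fun x => r x i k) (w n)) ->
  forall i : 'I_d, (i < j)%N -> forall k : 'I_(m i),
    \forall n \near \oo, ~ decreasing_at F (fun x => r x i k) (w n).
Proof.
(* Strong induction on the block index, then inside the block on the component index. *)
move=> p_ge fin_dec i; move: {2}(i : nat) (erefl (i : nat)) => a.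
elim/ltn_ind: a i => a IHi i ia ij k; move: {2}(k : nat) (erefl (k : nat)) => b.
elim/ltn_ind: b k => b IHk k kb; apply: fin_dec.
have nodec_lt : \forall n \near \oo, forall i' : 'I_d, (i' < i)%N ->
    forall k' : 'I_(m i'), ~ decreasing_at F (fun x => r x i' k') (w n).
  apply: filter_forall => i'; apply: filter_imply => i'i.
  apply: filter_forall => k'; apply: (IHi i') => //; first by rewrite -ia.
  exact: ltn_trans ij.
have nodec : \forall n \near \oo, forall k' : 'I_(m i), (k' < k)%N ->
    ~ decreasing_at F (fun x => r x i k') (w n).
  apply: filter_forall => k'; apply: filter_imply => k'k.
  by apply: (IHk k') => //; rewrite -kb.
near=> n; apply: (nested_ge_nonincreasing (LexPMSM_ge (w n))).
(* Since [i < j <= p (w n)], block [i] is in the prefix compared at [w n]. *)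
- by apply: leq_trans ij _; near: n.
- by near: n.
- by near: n.
Unshelve. all: by end_near. Qed.

Lemma parity_of_eventually_not_decreasing (w : traj S) :
  (forall x, (1 <= p x <= d)%N) ->
  (forall i k,
    (\forall n \near \oo, nonincreasing_at F (fun x => r x i k) (w n)) ->
    \forall n \near \oo, ~ decreasing_at F (fun x => r x i k) (w n)) ->
  parity p w.
Proof.
move=> p_range fin_dec.
have [|j io_j j_min] := @least_infinitely_often p w d.
  by move=> n; have /andP[] := p_range (w n).
exists j; split => //; apply/negP => odd_j.
have [N _ nodec] : \forall n \near \oo, forall i : 'I_d, (i < j)%N ->
    forall k : 'I_(m i), ~ decreasing_at F (fun x => r x i k) (w n).
  apply: filter_forall => i; apply: filter_imply => ij; apply: filter_forall => k.
  exact: eventually_not_decreasing (eventually_ge_least j_min) fin_dec i ij k.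
(* A visit to the odd priority [j] after time [N] would force a decrease in the first [j] blocks. *)
have [n [Nn pn]] := io_j N; have [_ _ _ /(_ (w n))] := r_PMSM.
rewrite pn => /(_ odd_j)/nested_gt_decreasing[i [ij [k]]].
exact: nodec Nn i ij k.
Qed.

End trajectories.

Theorem theorem5p10 (R : realType) (disp : measure_display)
    (S : measurableType disp) (F : R.-pker S ~> S)
    (d : nat) (p : S -> nat)
    (p_range : forall x, (1 <= p x <= d)%N)
    (p_meas : measurable_fun [set: S] p)
    (lexpmsm : has_LexPMSM F p d)
    (x0 : S) (P : probability (traj S) R)
    (P_traj : is_trajectory_measure F x0 P) :
  P (parity p) = 1%E.
Proof.
have [m [_ [r r_PMSM]]] := lexpmsm; have [r_ge0 r_meas _ _] := r_PMSM.
have mpar : measurable (parity p) by exact: measurable_parity.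
have : {ae P, forall w, parity p w}.
  have : {ae P, forall w : traj S, forall i k,
    (\forall n \near \oo, nonincreasing_at F (fun x => r x i k) (w n)) ->
    \forall n \near \oo, ~ decreasing_at F (fun x => r x i k) (w n)}.
    (* There are finitely many components, so their null sets combine into one. *)
    apply: filter_forall => i; apply: filter_forall => k.
    by apply: ae_eventually_not_decreasing P_traj => [x|]; [exact: r_ge0|exact: r_meas].
  by apply: filterS => w; exact: (parity_of_eventually_not_decreasing r_PMSM p_range).
move=> ae_parity; have P0 : P (~` parity p) = 0%E.
  by apply: measure_negligible; [exact: measurableC|exact: ae_parity].
by rewrite -[parity p]setCK probability_setC ?P0 ?sube0//; exact: measurableC.
Qed.
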